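(* Let $D$ be an integral domain, not a field, which is Noetherian (respectively, which satisfies the ascending chain condition on invertible ideals). Then: (1) $D$ is a PID if and only if $D=(D,\mathcal L_{d}(D)\setminus\{0\},\Pi)$ for $\Pi$ the set of proper nonzero principal ideals of $D$. (2) $D$ is a Dedekind domain if and only if $D=(D,\mathcal L_{d}(D)\setminus\{0\},\Pi)$ for $\Pi$ the set of proper invertible ideals of $D$.
   Context: $\mathcal L_{d}(D)\setminus\{0\}$ denotes the set of nonzero integral ideals of $D$ (including $D$ itself). A proper ideal is an ideal properly contained in $D$. For a set $\Pi$ of proper nonzero ideals of $D$, the notation $D=(D,\mathcal L_{d}(D)\setminus\{0\},\Pi)$ means: for every $A\in\mathcal L_{d}(D)\setminus\{0\}$ with $A\neq D$ there is $\pi\in\Pi$ with $A\subseteq\pi$. The ascending chain condition on invertible ideals refers to integral invertible ideals (every ascending chain of invertible ideals contained in $D$ stabilizes). *)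

(* Defs.v *)
From mathcomp Require Import all_boot all_order all_algebra.
From mathcomp Require Import boolp classical_sets.

Set Implicit Arguments.
Unset Strict Implicit.
Unset Printing Implicit Defensive.

Import GRing.Theory.
Local Open Scope classical_set_scope.
Local Open Scope ring_scope.

(* Ideals are arbitrary (Prop-valued) sets; the [idealr_closed] of
   ring_quotient is about decidable sets and moreover builds in properness,
   whereas here D is an ideal of itself. *)
Definition is_ideal (D : idomainType) (A : set D) : Prop :=
  [/\ A 0,
      forall x y, A x -> A y -> A (x + y)
    & forall a x, A x -> A (a * x)].

(* L_d(D) \ {0} *)
Definition nonzero_ideal (D : idomainType) (A : set D) : Prop :=
  is_ideal A /\ A <> [set 0].

Definition proper_set (D : idomainType) (A : set D) : Prop := A <> setT.

Definition principal_ideal (D : idomainType) (A : set D) : Prop :=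
  exists a : D, A = [set x * a | x in setT].

Definition prime_ideal (D : idomainType) (P : set D) : Prop :=
  [/\ is_ideal P, proper_set P & forall x y, P (x * y) -> P x \/ P y].

Definition maximal_ideal (D : idomainType) (M : set D) : Prop :=
  [/\ is_ideal M, proper_set M
    & forall A : set D, is_ideal A -> proper_set A -> M `<=` A -> A = M].

(* The quotient field of D is {fraction D}, in which D embeds by [tofrac]. *)
Definition in_frac (D : idomainType) (A : set D) : set {fraction D} :=
  [set tofrac a | a in A].

Definition fractional_ideal (D : idomainType) (J : set {fraction D}) : Prop :=
  [/\ J 0,
      forall x y, J x -> J y -> J (x + y),
      forall (a : D) x, J x -> J (tofrac a * x)
    & exists2 d : D, d != 0 &
        forall x, J x -> in_frac setT (tofrac d * x)].

(* I J: the finite sums of products of an element of I and an element of J. *)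
Definition ideal_mul (D : idomainType) (I J : set {fraction D}) :
    set {fraction D} :=
  [set z | exists s : seq ({fraction D} * {fraction D}),
     (forall p, p \in s -> I p.1 /\ J p.2) /\ z = \sum_(p <- s) p.1 * p.2].

Definition invertible_ideal (D : idomainType) (A : set D) : Prop :=
  is_ideal A /\
  exists2 J, fractional_ideal J & ideal_mul (in_frac A) J = in_frac setT.

Definition acc (D : idomainType) (F : set (set D)) : Prop :=
  forall I : nat -> set D,
    (forall n, F (I n)) -> (forall n, I n `<=` I n.+1) ->
    exists N, forall n, (N <= n)%N -> I n = I N.

Definition noetherian (D : idomainType) : Prop := acc (@is_ideal D).

Definition is_pid (D : idomainType) : Prop :=
  forall A : set D, is_ideal A -> principal_ideal A.

Definition integrally_closed (D : idomainType) : Prop :=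
  forall x : {fraction D},
    integralOver (@tofrac D) x -> in_frac setT x.

(* Fields are not excluded here. *)
Definition dedekind (D : idomainType) : Prop :=
  [/\ noetherian D, integrally_closed D
    & forall P : set D, prime_ideal P -> P <> [set 0] -> maximal_ideal P].

(* D = (D, Gamma, Pi) *)
Definition gamma_pi (D : idomainType) (Gamma Pi : set (set D)) : Prop :=
  forall A, Gamma A -> A <> setT -> exists2 P, Pi P & A `<=` P.

(* Main.v *)
Require Import Defs.
From mathcomp Require Import all_boot all_order all_algebra.
From mathcomp Require Import boolp classical_sets.
From mathcomp Require Import generic_quotient ring.

(**
Both equivalences rest on the same argument.  Let C be a set of invertible
ideals that contains D and is closed under products.  If every nonzero proper
ideal lies below a proper member of C, then every nonzero ideal is in C
([gamma_pi_monoid_absorbs]).  Otherwise, among the invertible ideals B that lie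
below some nonzero ideal A outside C, the chain condition provides a maximal
one.  A proper P in C lies above A, and for an invertible ideal to contain is to
divide: A = P A' and B = P B' with B' <= A'.  Here A' is not in C, since C is
closed under products, so maximality of B and B <= B' give B' = B.  Thus
B = P B, and cancelling B yields P = D, a contradiction.  With C the nonzero
principal ideals this says that D is a PID; with C the invertible ideals it says
that all nonzero ideals are invertible.  Both chain conditions of the theorem
imply the one used here, as invertible ideals are ideals.

If all nonzero ideals are invertible, then D is Dedekind.  Ascending chains of
ideals are, from some point on, constant zero or made of invertible ideals.  If
x is integral over D, some d != 0 satisfies d D[x] <= D; this is an invertible
ideal stable under x, so x is in D.  If a nonzero prime P is contained in a
proper ideal A, then P = A B; were P distinct from A, primality would give
B <= P, hence P <= A P and A = D after cancelling P.

If D is Dedekind, a nonzero proper ideal lies below a maximal ideal M, and M is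
invertible ([dedekind_maximal_invertible]).  For 0 != a in M, M is the
annihilator of some b modulo a: an ideal maximal among the annihilators
((a) : b) contained in M is prime, nonzero, hence maximal, hence equal to M.
Then M (a, b) = a N for an ideal N above M, so N is D or M.  If N = D, then M is
invertible.  If N = M, then b / a maps M to itself, so it is integral over D
because D is Noetherian; being integrally closed, D contains b / a and a divides
b, contradicting that M is proper.

The converse for PIDs is immediate: a nonzero proper ideal is itself principal.
*)

Set Implicit Arguments.
Unset Strict Implicit.
Unset Printing Implicit Defensive.

Import GRing.Theory.
Local Open Scope classical_set_scope.
Local Open Scope ring_scope.

(** * Maximal elements from chain conditions *)

Section MaximalElements.
Variable D : idomainType.
Implicit Types (A B C : set D) (F S : set (set D)).

(** If no member of S were maximal, choosing a strictly larger member again and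
again would produce an ascending chain in F that never stabilizes. *)
Lemma acc_maximal F S : acc F -> S `<=` F -> S !=set0 ->
  exists2 M, S M & forall A, S A -> M `<=` A -> A = M.
Proof.
move=> accF SF [A0 SA0]; apply: contrapT => noM.
have step (A : {A | S A}) : exists B : {B | S B},
    sval A `<=` sval B /\ sval B <> sval A.
  case: A => A SA /=; apply: contrapT => noB; apply: noM; exists A => //.
  move=> B SB AB.
  by apply: contrapT => nAB; apply: noB; exists (exist _ B SB).
have [f fP] := choice step.
pose I n := sval (iter n f (exist _ A0 SA0)).
have [n|n|N stab] := accF I; first exact/SF/(svalP (iter n f _)).
  exact: (fP _).1.
by apply: (fP (iter N f (exist _ A0 SA0))).2; exact: stab N.+1 (leqnSn N).
Qed.

End MaximalElements.

(** * Products of ideals inside the domain *)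

Section IdealArithmetic.
Variable D : idomainType.
Implicit Types (A B C P : set D) (a b c x y z : D).

Lemma ideal0 A : is_ideal A -> A 0. Proof. by case. Qed.
Lemma idealD A x y : is_ideal A -> A x -> A y -> A (x + y).
Proof. by case=> _ + _; exact. Qed.
Lemma idealMl A a x : is_ideal A -> A x -> A (a * x).
Proof. by case=> _ _; exact. Qed.
Lemma idealMr A a x : is_ideal A -> A x -> A (x * a).
Proof. by move=> iA Ax; rewrite mulrC; exact: idealMl. Qed.

Lemma ideal1_setT A : is_ideal A -> A 1 -> A = setT.
Proof.
move=> iA A1; apply/seteqP; split=> // x _.
by rewrite -[x]mulr1; exact: idealMl.
Qed.

Lemma nonzero_elt A : is_ideal A -> A <> [set 0] -> exists2 a, A a & a != 0.
Proof.
move=> iA nA; apply: contrapT => noa; apply: nA; apply/seteqP.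
split=> [a Aa|_ ->]; last exact: ideal0.
by apply: contrapT => /eqP a0; apply: noa; exists a.
Qed.

Lemma neq_set0 A a : A a -> a != 0 -> A <> [set 0].
Proof. by move=> + + A0; rewrite A0 => ->; rewrite eqxx. Qed.

Definition pideal a : set D := [set x * a | x in setT].

Lemma pidealP a z : pideal a z <-> exists x, z = x * a.
Proof. by split=> [[x _ <-]|[x ->]]; exists x. Qed.

Lemma pideal_ideal a : is_ideal (pideal a).
Proof.
split=> [|_ _ [x _ <-] [y _ <-]|b _ [x _ <-]]; apply/pidealP.
- by exists 0; rewrite mul0r.
- by exists (x + y); rewrite mulrDl.
- by exists (b * x); rewrite mulrA.
Qed.

Lemma mem_pideal a : pideal a a.
Proof. by apply/pidealP; exists 1; rewrite mul1r. Qed.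

Lemma pideal_sub A a : is_ideal A -> A a -> pideal a `<=` A.
Proof. by move=> iA Aa _ [x _ <-]; exact: idealMl. Qed.

Definition colon A B : set D := [set x | forall b, B b -> A (x * b)].

Lemma colon_ideal A B : is_ideal A -> is_ideal (colon A B).
Proof.
move=> iA; split=> [b Bb|x y Ax Ay b Bb|a x Ax b Bb].
- by rewrite mul0r; exact: ideal0.
- by rewrite mulrDl; apply: idealD => //; [exact: Ax|exact: Ay].
- by rewrite -mulrA; apply: idealMl => //; exact: Ax.
Qed.

(** The product is encoded as the intersection of the ideals that contain all
a * b, so that its universal property holds by definition and finite sums never
have to be manipulated. *)
Definition imul A B : set D :=
  [set z | forall C, is_ideal C ->
           (forall a b, A a -> B b -> C (a * b)) -> C z].

Lemma imul_ideal A B : is_ideal (imul A B).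
Proof.
split=> [|x y Ax Ay|a x Ax] C iC ABC.
- exact: ideal0.
- by apply: idealD => //; [exact: Ax|exact: Ay].
- by apply: idealMl => //; exact: Ax.
Qed.

Lemma mem_imul A B a b : A a -> B b -> imul A B (a * b).
Proof. by move=> Aa Bb C _; exact. Qed.

Lemma imul_sub A B C : is_ideal C ->
  (forall a b, A a -> B b -> C (a * b)) -> imul A B `<=` C.
Proof. by move=> iC ABC z; exact. Qed.

Lemma imulS A B C : A `<=` B -> imul A C `<=` imul B C.
Proof.
move=> AB; apply: imul_sub (imul_ideal _ _) _ => a c Aa Cc.
by apply: mem_imul => //; exact: AB.
Qed.

Lemma imulC : commutative imul.
Proof.
move=> A B; wlog suff: A B / imul A B `<=` imul B A.
  by move=> AB; apply/seteqP.
apply: imul_sub (imul_ideal _ _) _ => a b Aa Bb.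
by rewrite mulrC; exact: mem_imul.
Qed.

(** To see that z * c is in A (B C) for z in A B, it is enough that the ideal
(A (B C) : C) contains all a * b. *)
Lemma imulA : associative imul.
Proof.
have sub A B C : imul (imul A B) C `<=` imul A (imul B C).
  apply: imul_sub (imul_ideal _ _) _ => z c ABz Cc.
  apply: (ABz (colon _ C)) Cc; first exact/colon_ideal/imul_ideal.
  by move=> a b Aa Bb c' Cc'; rewrite -mulrA; do 2?apply: mem_imul.
move=> A B C; apply/seteqP; split; last exact: sub.
rewrite [imul A _]imulC [imul B _]imulC [imul _ C]imulC [imul A _]imulC.
exact: sub.
Qed.

Lemma imulCA : left_commutative imul.
Proof. by move=> A B C; rewrite !imulA [imul A B]imulC. Qed.

Lemma imulT A : is_ideal A -> imul A setT = A.
Proof.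
move=> iA; apply/seteqP; split.
  by apply: imul_sub => // a b Aa _; exact: idealMr.
by move=> a Aa; rewrite -[a]mulr1; exact: mem_imul.
Qed.

Lemma imul_subl A B : is_ideal A -> imul A B `<=` A.
Proof. by move=> iA; apply: imul_sub => // a b Aa _; exact: idealMr. Qed.

Lemma imul_pideal a b : imul (pideal a) (pideal b) = pideal (a * b).
Proof.
apply/seteqP; split.
  apply: imul_sub (pideal_ideal _) _ => _ _ [x _ <-] [y _ <-].
  by apply/pidealP; exists (x * y); ring.
by apply: pideal_sub (imul_ideal _ _) _; apply: mem_imul; exact: mem_pideal.
Qed.

Lemma imul_pidealE c A : is_ideal A -> imul (pideal c) A = [set c * a | a in A].
Proof.
move=> iA; apply/seteqP; split; last first.
  by move=> _ [a Aa <-]; apply: mem_imul => //; exact: mem_pideal.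
apply: imul_sub => [|_ a [x _ <-] Aa]; last first.
  by exists (x * a); [exact: idealMl|ring].
split=> [|_ _ [x Ax <-] [y Ay <-]|b _ [x Ax <-]].
- by exists 0; [exact: ideal0|rewrite mulr0].
- by exists (x + y); [exact: idealD|rewrite mulrDr].
- by exists (b * x); [exact: idealMl|ring].
Qed.

Lemma pideal_cancel c A B : c != 0 -> is_ideal A -> is_ideal B ->
  imul (pideal c) A `<=` imul (pideal c) B -> A `<=` B.
Proof.
move=> c0 iA iB; rewrite !imul_pidealE// => AB a Aa.
have [b Bb /(mulfI c0) <- //] : [set c * b | b in B] (c * a).
by apply: AB; exists a.
Qed.

Lemma pideal_divides c A : is_ideal A -> A `<=` pideal c ->
  exists2 B, is_ideal B & A = imul (pideal c) B.
Proof.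
move=> iA Ac; exists (colon A [set c]); first exact: colon_ideal.
apply/seteqP; split; last first.
  apply: imul_sub => // _ b [x _ <-] Ab.
  by rewrite -mulrA [c * b]mulrC; apply: idealMl => //; exact: Ab.
move=> a Aa; have [x _ xc] := Ac _ Aa; rewrite -xc mulrC.
by apply: mem_imul (mem_pideal c) _ => _ ->; rewrite xc.
Qed.

(** This expresses that c^-1 B is the inverse of the fractional ideal A, with
denominators cleared. *)
Definition inverse_upto A B c := [/\ is_ideal B, c != 0 & imul A B = pideal c].

Lemma inverse_upto_cancel P Q c A B :
  inverse_upto P Q c -> is_ideal A -> is_ideal B ->
  imul P A `<=` imul P B -> A `<=` B.
Proof.
move=> [_ c0 PQ] iA iB AB; apply: (pideal_cancel c0) => //.
rewrite -PQ -!imulA imulCA [X in _ `<=` X]imulCA.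
by rewrite ![imul Q _]imulC; exact: imulS.
Qed.

(** To contain is to divide: A Q is contained in P Q = (c), so A Q = c B, and
cancelling c in c A = P Q A = c P B gives A = P B. *)
Lemma inverse_upto_divides P Q c A : is_ideal P -> inverse_upto P Q c ->
  is_ideal A -> A `<=` P -> exists2 B, is_ideal B & A = imul P B.
Proof.
move=> iP [_ c0 PQ] iA AP.
have [|B iB AQ] := pideal_divides (c := c) (imul_ideal A Q).
  by rewrite -PQ; exact: imulS.
have eqc : imul (pideal c) A = imul (pideal c) (imul P B).
  by rewrite imulCA -AQ -PQ -imulA [imul Q A]imulC.
exists B => //; apply/seteqP; split; apply: (pideal_cancel c0) => //;
  by [exact: imul_ideal|rewrite eqc].
Qed.

End IdealArithmetic.

(** * Invertibility without fractions *)

Section Fractions.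
Variable D : idomainType.
Implicit Types (A B P : set D) (a b c : D).
Local Notation "x %:F" := (@tofrac D x).

Lemma frac_quotient (x : {fraction D}) : exists a b, b != 0 /\ x = a%:F / b%:F.
Proof.
rewrite -[x]reprK; case: (repr x) => -[a b] /= b0; exists a, b; split=> //.
apply: (@mulIf _ b%:F); first by rewrite tofrac_eq0.
rewrite divfK ?tofrac_eq0// !piE; apply/eqP; rewrite FracField.equivf_def /=.
by rewrite !numden_Ratio ?mulf_neq0 ?oner_neq0//=; apply/eqP; ring.
Qed.

Lemma in_fracT_sum (s : seq {fraction D}) :
  (forall x, x \in s -> in_frac setT x) -> in_frac setT (\sum_(x <- s) x).
Proof.
elim: s => [|x s IHs] sD; first by rewrite big_nil -tofrac0; exists 0.
have [a _ ax] := sD x (mem_head _ _).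
have [b _ bs] : in_frac setT (\sum_(y <- s) y).
  by apply: IHs => y ys; apply: sD; rewrite in_cons ys orbT.
by rewrite big_cons -ax -bs -tofracD; exists (a + b).
Qed.

(** If d is a common denominator of the inverse J of A, then B = d J is an ideal
of D and A B = d A J = (d). *)
Lemma invertible_inverse_upto A :
  invertible_ideal A -> exists B c, inverse_upto A B c.
Proof.
move=> [iA [J [J0 JD JM [d d0 dJ]] AJ]].
pose B : set D := [set y | exists2 j, J j & y%:F = d%:F * j].
have iB : is_ideal B.
  split=> [|x y [j Jj xj] [k Jk yk]|a x [j Jj xj]].
  - by exists 0; rewrite // mulr0 tofrac0.
  - by exists (j + k); [exact: JD|rewrite tofracD xj yk mulrDr].
  - by exists (a%:F * j); [exact: JM|rewrite tofracM xj mulrCA].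
exists B, d; split=> //; apply/seteqP; split.
  apply: imul_sub (pideal_ideal _) _ => a b Aa [j Jj bj].
  have [z _ zE] : in_frac setT (a%:F * j).
    rewrite -AJ; exists [:: (a%:F, j)]; split=> [p|]; last by rewrite big_seq1.
    by rewrite inE => /eqP ->; split=> //; exists a.
  apply/pidealP; exists z; apply/eqP; rewrite -tofrac_eq !tofracM zE bj.
  by apply/eqP; ring.
apply: pideal_sub (imul_ideal _ _) _.
have [s [sAJ s1]] : ideal_mul (in_frac A) J 1%:F by rewrite AJ; exists 1.
suff [z ABz zE] : exists2 z, imul A B z & z%:F = d%:F * 1%:F.
  by move/eqP: zE; rewrite -tofracM tofrac_eq mulr1 => /eqP <-.
rewrite {}s1; elim: s sAJ => [|p s IHs] sAJ.
  by exists 0; [exact: ideal0 (imul_ideal _ _)|rewrite big_nil tofrac0 mulr0].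
have [z ABz zE] : exists2 z, imul A B z & z%:F = d%:F * \sum_(p <- s) p.1 * p.2.
  by apply: IHs => q qs; apply: sAJ; rewrite in_cons qs orbT.
have [[a Aa ap] Jp] := sAJ p (mem_head _ _).
have [b _ bp] := dJ _ Jp.
exists (a * b + z).
  by apply: idealD (imul_ideal _ _) _ ABz; apply: mem_imul => //; exists p.2.
by rewrite big_cons tofracD tofracM ap bp zE; ring.
Qed.

(** The inverse of A is c^-1 B. *)
Lemma inverse_upto_invertible A B c :
  is_ideal A -> inverse_upto A B c -> invertible_ideal A.
Proof.
move=> iA [iB c0 AB]; split=> //.
have c0F : c%:F != 0 by rewrite tofrac_eq0.
exists [set b%:F / c%:F | b in B].
  split=> [|_ _ [x Bx <-] [y By <-]|a _ [x Bx <-]|].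
  - by exists 0; [exact: ideal0|rewrite tofrac0 mul0r].
  - by exists (x + y); [exact: idealD|rewrite tofracD mulrDl].
  - by exists (a * x); [exact: idealMl|rewrite tofracM mulrA].
  - by exists c => // _ [x _ <-]; exists x; rewrite // mulrC divfK.
set J := (X in ideal_mul _ X).
apply/seteqP; split=> [_ [s [sAJ ->]]|_ [z _ <-]].
  rewrite -(big_map (fun p => p.1 * p.2) xpredT id).
  apply: in_fracT_sum => _ /mapP[p /sAJ[[a Aa <-] [b Bb <-]] ->].
  have /pidealP[x abx] : pideal c (a * b) by rewrite -AB; exact: mem_imul.
  by exists x; rewrite // mulrA -tofracM abx tofracM mulfK.
pose C : set D := [set y | ideal_mul (in_frac A) J (y%:F / c%:F)].
suff : C (z * c) by rewrite /C /= tofracM mulfK.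
have : imul A B (z * c) by rewrite AB; apply/pidealP; exists z.
apply: imul_sub => [|a b Aa Bb]; last first.
  exists [:: (a%:F, b%:F / c%:F)].
  split; last by rewrite big_seq1 tofracM mulrA.
  by move=> p; rewrite inE => /eqP ->; split; [exists a|exists b].
split=> [|x y [s [sAJ sx]] [t [tAJ ty]]|a x [s [sAJ sx]]].
- by exists [::]; split=> //; rewrite big_nil tofrac0 mul0r.
- exists (s ++ t); split; last by rewrite big_cat/= -sx -ty tofracD mulrDl.
  by move=> p; rewrite mem_cat => /orP[/sAJ|/tAJ].
- exists [seq (a%:F * p.1, p.2) | p <- s]; split.
    move=> _ /mapP[p /sAJ[[u Au up] Jp] ->]; split=> //=.
    by exists (a * u); [exact: idealMl|rewrite tofracM up].
  rewrite big_map tofracM -mulrA sx big_distrr /=.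
  by apply: eq_bigr => p _; rewrite mulrA.
Qed.

Lemma setT_invertible : invertible_ideal (setT : set D).
Proof.
apply: (@inverse_upto_invertible _ setT 1) => //.
split=> //; first exact: oner_neq0.
by rewrite imulT//; apply/esym/ideal1_setT;
  [exact: pideal_ideal|exact: mem_pideal].
Qed.

Lemma pideal_invertible a : a != 0 -> invertible_ideal (pideal a).
Proof.
move=> a0; apply: (@inverse_upto_invertible _ setT a).
  exact: pideal_ideal.
by split=> //; rewrite imulT//; exact: pideal_ideal.
Qed.

Lemma imul_invertible A B :
  invertible_ideal A -> invertible_ideal B -> invertible_ideal (imul A B).
Proof.
move=> /invertible_inverse_upto[A' [a [iA' a0 AA']]].
move=> /invertible_inverse_upto[B' [b [iB' b0 BB']]].
apply: (@inverse_upto_invertible _ (imul A' B') (a * b)).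
  exact: imul_ideal.
split; [exact: imul_ideal|exact: mulf_neq0|].
by rewrite -imulA [imul B _]imulCA imulA AA' BB' imul_pideal.
Qed.

Lemma invertible_factor A B : is_ideal B ->
  invertible_ideal (imul A B) -> invertible_ideal B.
Proof.
move=> iB /invertible_inverse_upto[C [c [iC c0 ABC]]].
apply: (@inverse_upto_invertible _ (imul A C) c) => //.
by split=> //; [exact: imul_ideal|rewrite imulCA imulA].
Qed.

Lemma invertible_divides P A : invertible_ideal P -> is_ideal A ->
  A `<=` P -> exists2 B, is_ideal B & A = imul P B.
Proof.
move=> invP; have [Q [c PQ]] := invertible_inverse_upto invP.
by apply: inverse_upto_divides PQ; case: invP.
Qed.

Lemma invertible_cancel P A B :
  invertible_ideal P -> is_ideal A -> is_ideal B ->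
  imul P A `<=` imul P B -> A `<=` B.
Proof.
by move=> /invertible_inverse_upto[Q [c PQ]]; exact: inverse_upto_cancel PQ.
Qed.

End Fractions.

(** * The chain condition and monoids of invertible ideals *)

Section Factorization.
Variable D : idomainType.
Variable C : set (set D).
Hypothesis C_invertible : C `<=` @invertible_ideal D.
Hypothesis CT : C setT.
Hypothesis CM : forall A B, C A -> C B -> C (imul A B).

(** B is chosen maximal among the invertible ideals below an ideal outside C.
Dividing both B and the ideal above it by a proper member P of C stays in the
same family and enlarges B, so B = P B, which is impossible for proper P. *)
Lemma gamma_pi_monoid_absorbs : acc (@invertible_ideal D) ->
  gamma_pi (@nonzero_ideal D) [set P | proper_set P /\ C P] ->
  forall A, nonzero_ideal A -> C A.
Proof.
move=> acc_inv above A0 [iA0 nzA0]; apply: contrapT => nCA0.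
pose S : set (set D) := [set B | invertible_ideal B /\
  exists A, [/\ is_ideal A, ~ C A & B `<=` A]].
have [||B [invB [A [iA nCA BA]]] maxB] := @acc_maximal D _ S acc_inv.
- by move=> B [].
- have [a Aa a0] := nonzero_elt iA0 nzA0.
  (* any nonzero principal ideal below A0 starts the search *)
  exists (pideal a); split; first exact: pideal_invertible.
  by exists A0; split=> //; exact: pideal_sub.
have iB := invB.1.
have nzB (I : set D) : is_ideal I -> B `<=` I -> nonzero_ideal I.
  move=> iI BI; split=> //.
  have [B' [c [_ c0 BB']]] := invertible_inverse_upto invB.
  have /(imul_subl iB)/BI Ic : imul B B' c by rewrite BB'; exact: mem_pideal.
  exact: neq_set0 Ic c0.
have [|P [properP CP] AP] := above A (nzB A iA BA).
  by move=> AT; rewrite AT in nCA.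
have invP := C_invertible CP; have iP := invP.1.
have [A' iA' AE] := invertible_divides invP iA AP.
have [B' iB' BE] := invertible_divides invP iB (subset_trans BA AP).
have B'A' : B' `<=` A'.
  by apply: (invertible_cancel invP) => //; rewrite -AE -BE.
apply: properP; apply: ideal1_setT => //.
have BB' : B' = B.
  apply: maxB; last by rewrite BE imulC; exact: imul_subl.
  split; first by apply: (@invertible_factor _ P) => //; rewrite -BE.
  by exists A'; split=> // CA'; apply: nCA; rewrite AE; exact: CM.
suff : setT `<=` P by exact.
apply: (invertible_cancel invB) => //.
by rewrite imulT// imulC -[in imul P B]BB' -BE.
Qed.

End Factorization.

(** * Integral elements and maximal ideals *)

Section Integrality.
Variable D : idomainType.
Implicit Types (A B P M : set D) (a b c : D).
Local Notation "x %:F" := (@tofrac D x).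

(** Multiplying x A <= A by the inverse of A gives x D <= D.  With x = u / v and
A B = (c) this reads u c in (v c). *)
Lemma invertible_stable A (x : {fraction D}) : invertible_ideal A ->
  (forall a, A a -> in_frac A (x * a%:F)) -> in_frac setT x.
Proof.
move=> /invertible_inverse_upto[B [c [_ c0 AB]]] xA.
have [u [v [v0 xE]]] := frac_quotient x.
have v0F : v%:F != 0 by rewrite tofrac_eq0.
have /pidealP[y yE] : pideal (v * c) (u * c).
  have : imul A B c by rewrite AB; exact: mem_pideal.
  rewrite -[_ (u * c)]/([set z | pideal (v * c) (u * z)] c).
  apply: imul_sub => [|a b Aa Bb].
    have [i0 iD iM] := pideal_ideal (v * c).
    split=> [|z t /= uz ut|d z /= uz];
      rewrite /= ?mulr0 ?mulrDr ?[u * _]mulrCA//.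
      exact: iD.
    exact: iM.
  have [a' Aa' a'E] := xA a Aa.
  have /pidealP[t tE] : pideal c (a' * b) by rewrite -AB; exact: mem_imul.
  apply/pidealP; exists t; rewrite [RHS]mulrCA -tE !mulrA; congr (_ * _).
  apply/eqP; rewrite -tofrac_eq !tofracM a'E xE; apply/eqP.
  by rewrite mulrA mulrCA mulfV// mulr1.
exists y => //; apply: (mulIf v0F); rewrite xE divfK//.
apply/eqP; rewrite -tofracM tofrac_eq; apply/eqP.
by apply: (mulIf c0); rewrite yE mulrA.
Qed.

Definition frac_poly (p : {poly D}) := map_poly (@tofrac D) p.

(** If x = a / b is a root of a monic q, then modulo q every polynomial has
degree below that of q, so b ^ size q clears the denominators of all of D[x]. *)
Lemma integral_denominator (x : {fraction D}) : integralOver (@tofrac D) x ->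
  exists2 d, d != 0 & forall p, in_frac setT (d%:F * (frac_poly p).[x]).
Proof.
move=> [q q_monic /rootP qx0]; have [a [b [b0 xE]]] := frac_quotient x.
have b0F : b%:F != 0 by rewrite tofrac_eq0.
exists (b ^+ size q) => [|p]; first exact: expf_neq0.
rewrite (Pdiv.RingMonic.rdivp_eq q_monic p) /frac_poly rmorphD rmorphM /=.
rewrite hornerD hornerM qx0 mulr0 add0r.
set r := Pdiv.Ring.rmodp _ _.
have rq : (size r < size q)%N by rewrite Pdiv.Ring.ltn_rmodp monic_neq0.
rewrite (@horner_coef_wide _ (size q)); last first.
  by rewrite (leq_trans (size_poly _ _))// ltnW.
rewrite mulr_sumr -(big_map (fun i : 'I_(size q) => _) xpredT id).
apply: in_fracT_sum => _ /mapP[[i iq] _ ->]; rewrite coef_map /=.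
exists (r`_i * (b ^+ (size q - i) * a ^+ i)) => //.
rewrite !tofracM !tofracXn xE expr_div_n -(subnK (ltnW iq)) exprD.
rewrite [RHS]mulrCA; congr (_ * _); rewrite addnK -mulrA; congr (_ * _).
by rewrite mulrC divfK// expf_neq0.
Qed.

(** For d a common denominator of D[x], d D[x] is a nonzero ideal of D, hence
invertible, and it is stable under x. *)
Lemma all_invertible_integrally_closed :
  (forall A, nonzero_ideal A -> invertible_ideal A) -> integrally_closed D.
Proof.
move=> inv x /integral_denominator[d d0 dD].
pose A : set D := [set y | exists p, y%:F = d%:F * (frac_poly p).[x]].
have iA : is_ideal A.
  split=> [|y z [p yp] [q zq]|a y [p yp]].
  - by exists 0; rewrite tofrac0 /frac_poly rmorph0 horner0 mulr0.
  - by exists (p + q); rewrite tofracD yp zq /frac_poly rmorphD hornerD mulrDr.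
  - by exists (a *: p); rewrite /frac_poly map_polyZ hornerZ tofracM yp mulrCA.
apply: (@invertible_stable A).
  apply: inv; split=> //; apply: neq_set0 d0.
  by exists 1; rewrite /frac_poly rmorph1 hornerC mulr1.
move=> a [p ap]; have [y _ yE] := dD ('X * p).
have xaE : x * a%:F = d%:F * (frac_poly ('X * p)).[x].
  by rewrite /frac_poly rmorphM /= map_polyX hornerM hornerX ap mulrCA.
by rewrite xaE -yE; exists y => //; exists ('X * p).
Qed.

(** If P <= A then P = A B.  An element of A outside the prime P forces B <= P,
so P = A B <= A P, and cancelling P leaves A = D. *)
Lemma all_invertible_prime_maximal :
  (forall A, nonzero_ideal A -> invertible_ideal A) ->
  forall P, prime_ideal P -> P <> [set 0] -> maximal_ideal P.
Proof.
move=> inv P [iP properP primeP] nzP; split=> // A iA properA PA.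
have invP : invertible_ideal P by exact: inv.
have invA : invertible_ideal A.
  have [p /PA Ap p0] := nonzero_elt iP nzP.
  by apply: inv; split=> //; exact: neq_set0 Ap p0.
have [B iB PE] := invertible_divides invA iP PA.
apply/seteqP; split=> // a Aa; apply: contrapT => nPa.
have BP : B `<=` P.
  by move=> b Bb; have /primeP[] : P (a * b) by rewrite PE; exact: mem_imul.
apply: properA; apply: ideal1_setT => //.
suff : setT `<=` A by exact.
apply: (invertible_cancel invP) => //; rewrite imulT// {1}PE imulC.
exact: imulS.
Qed.

(** The determinant trick is replaced by a chain: as all m x^n lie in M, the
elements m p(x) with p of size at most n form an ascending chain of ideals
of D.  When it stabilizes, m x^N = m p(x) for some p of degree below N, a
monic equation for x. *)
Lemma noetherian_stable_integral M m (x : {fraction D}) : noetherian D ->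
  is_ideal M -> M m -> m != 0 -> (forall y, M y -> in_frac M (x * y%:F)) ->
  integralOver (@tofrac D) x.
Proof.
move=> noeth iM Mm m0 xM.
have mx n : in_frac M (m%:F * x ^+ n).
  elim: n => [|n [y My yE]]; first by exists m; rewrite ?mulr1.
  by rewrite exprS mulrCA -yE; exact: xM.
pose I n : set D :=
  [set y | exists2 p : {poly D}, (size p <= n)%N
                 & y%:F = m%:F * (frac_poly p).[x]].
have [n|n y [p pn yE]|N stab] := noeth I.
- split=> [|y z [p pn yp] [q qn zq]|a y [p pn yp]].
  + by exists 0; rewrite ?size_poly0// tofrac0 /frac_poly rmorph0 horner0 mulr0.
  + exists (p + q); first by rewrite (leq_trans (size_polyD _ _))// geq_max pn.
    by rewrite tofracD yp zq /frac_poly rmorphD hornerD mulrDr.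
  + exists (a *: p); first exact: leq_trans (size_scale_leq _ _) pn.
    by rewrite /frac_poly map_polyZ hornerZ tofracM yp mulrCA.
- by exists p => //; exact: leqW.
have [y _ yE] := mx N.
have [p pN pE] : I N y.
  rewrite -(stab N.+1)//; exists 'X^N; first by rewrite size_polyXn.
  by rewrite /frac_poly map_polyXn hornerXn.
exists ('X^N - p).
  by rewrite monicE lead_coefDl ?lead_coefXn// size_polyN size_polyXn.
apply/rootP; rewrite rmorphB /= map_polyXn hornerD hornerN hornerXn.
apply: (@mulfI _ m%:F); first by rewrite tofrac_eq0.
by rewrite mulr0 mulrBr -yE pE subrr.
Qed.

(** For y outside M and x y in M, the ideal (M : y) contains M and is proper, so
it equals M and contains x. *)
Lemma maximal_prime M : maximal_ideal M -> prime_ideal M.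
Proof.
move=> [iM properM maxM]; split=> // x y Mxy.
have [|nMx] := pselect (M x); [by left|right].
have [My|] := pselect (colon M [set y] = setT).
  have : colon M [set y] 1 by rewrite My.
  by move=> /(_ y erefl); rewrite mul1r.
move=> properC; exfalso; apply: nMx.
rewrite -(maxM (colon M [set y])) => [_ ->//|||z Mz _ ->].
- exact: colon_ideal.
- by [].
- exact: idealMr.
Qed.

(** In dimension one, M is an associated prime of (a).  Take ((a) : b) maximal
among the ideals of this form contained in M, and let x y be in it.  If
((a) : b y) is contained in M, it equals ((a) : b) and contains x.  Otherwise it
contains some s outside M; since M is prime, ((a) : b s) is contained in M, so
it equals ((a) : b), and it contains y.  Hence ((a) : b) is prime, so maximal. *)
Lemma maximal_associated M a : noetherian D ->
  (forall P, prime_ideal P -> P <> [set 0] -> maximal_ideal P) ->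
  maximal_ideal M -> M a -> a != 0 ->
  exists b, colon (pideal a) [set b] = M.
Proof.
move=> noeth dim1 maxM Ma a0.
have [iM properM primeM] := maximal_prime maxM.
pose I b := colon (pideal a) [set b].
have iI b : is_ideal (I b) by exact/colon_ideal/pideal_ideal.
have IE b x : I b x <-> pideal a (x * b) by split=> [|? _ ->]//; exact.
pose S : set (set D) := [set J | J `<=` M /\ exists b, J = I b].
have [||J [IM [b JE]] maxJ] := @acc_maximal D _ S noeth.
- by move=> _ [_ [b ->]].
- exists (I 1); split; last by exists 1.
  by move=> x /IE; rewrite mulr1 => xa; exact: (pideal_sub iM Ma xa).
rewrite {J}JE in IM maxJ.
have Ia : I b a.
  by apply/IE; apply: (idealMr _ (pideal_ideal a)); exact: mem_pideal.
have sub c : I b `<=` I (b * c).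
  move=> x /IE xb; apply/IE; rewrite mulrA.
  by apply: idealMr => //; exact: pideal_ideal.
have stab c : I (b * c) `<=` M -> I (b * c) = I b.
  by move=> IbcM; apply: maxJ; [split=> //; exists (b * c)|exact: sub].
have primeI : prime_ideal (I b).
  split=> // [IT|x y Ixy].
    by apply: properM; apply: ideal1_setT => //; apply: IM; rewrite IT.
  have [sM|] := pselect (I (b * y) `<=` M).
    by left; rewrite -(stab y)//; apply/IE; rewrite mulrCA mulrC; exact/IE.
  move=> /existsNP[s /not_implyP[Is nMs]]; right; rewrite -(stab s).
    apply/IE; have -> : y * (b * s) = s * (b * y) by ring.
    exact/IE.
  move=> t /IE tbs; have /IM/primeM[] // : I b (t * s).
  by apply/IE; rewrite -mulrA [s * b]mulrC.
have [_ properI maxI] : maximal_ideal (I b) by apply: dim1 (neq_set0 Ia a0).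
by exists b; apply/esym; exact: maxI.
Qed.

(** With M = ((a) : b), the inverse of M is a^-1 (a, b), provided that the ideal
N = a^-1 M (a, b) is D.  It contains M, and N = M would make b / a integral. *)
Lemma dedekind_maximal_invertible M : dedekind D ->
  maximal_ideal M -> M <> [set 0] -> invertible_ideal M.
Proof.
move=> [noeth intcl dim1] maxM nzM; have [iM properM maxM'] := maxM.
have [a Ma a0] := nonzero_elt iM nzM.
have a0F : a%:F != 0 by rewrite tofrac_eq0.
have [b bM] := maximal_associated noeth dim1 maxM Ma a0.
have Mb x : M x -> pideal a (x * b) by rewrite -bM => /(_ b erefl).
have nab : ~ pideal a b.
  move=> ab; apply: properM; apply: ideal1_setT => //; rewrite -bM => _ ->.
  by rewrite mul1r.
pose B : set D := [set u * a + v * b | u in setT & v in setT].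
have iB : is_ideal B.
  split=> [|_ _ [u _ [v _ <-]] [u' _ [v' _ <-]]|c _ [u _ [v _ <-]]].
  - by exists 0 => //; exists 0 => //; ring.
  - by exists (u + u') => //; exists (v + v') => //; ring.
  - by exists (c * u) => //; exists (c * v) => //; ring.
have Ba : B a by exists 1 => //; exists 0 => //; ring.
have Bb : B b by exists 0 => //; exists 1 => //; ring.
have MBa : imul M B `<=` pideal a.
  apply: imul_sub (pideal_ideal _) _ => m _ Mm [u _ [v _ <-]].
  have /pidealP[z mb] := Mb _ Mm.
  apply/pidealP; exists (m * u + v * z).
  by rewrite mulrDr [m * (v * b)]mulrCA mb; ring.
have [N iN MBE] := pideal_divides (imul_ideal M B) MBa.
have memN z : N z <-> imul M B (a * z).
  rewrite MBE imul_pidealE//; split=> [Nz|[y Ny /(mulfI a0) <-]//].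
  by exists z.
have MN : M `<=` N by move=> m Mm; apply/memN; rewrite mulrC; exact: mem_imul.
have NT : N = setT.
  apply: contrapT => properN; apply: nab.
  have NM := maxM' N iN properN MN.
  have [y _ yE] : in_frac setT (b%:F / a%:F).
    apply/intcl/(noetherian_stable_integral noeth iM Ma a0) => m Mm.
    have /pidealP[z mb] := Mb _ Mm.
    exists z.
      by rewrite -NM; apply/memN; rewrite [a * z]mulrC -mb; exact: mem_imul.
    by apply: (mulIf a0F); rewrite mulrAC divfK// -!tofracM -mb mulrC.
  apply/pidealP; exists y; apply/eqP; rewrite -tofrac_eq tofracM yE divfK//.
apply: (@inverse_upto_invertible _ _ B a) => //; split=> //.
by rewrite MBE NT imulT//; exact: pideal_ideal.
Qed.

Lemma noetherian_maximal_above A : noetherian D -> is_ideal A -> proper_set A ->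
  exists2 M, maximal_ideal M & A `<=` M.
Proof.
move=> noeth iA properA.
pose S : set (set D) := [set B | [/\ is_ideal B, proper_set B & A `<=` B]].
have [||M [iM properM AM] maxM] := @acc_maximal D _ S noeth.
- by move=> B [].
- by exists A; split.
- exists M => //; split=> // B iB properB MB.
  by apply: maxM => //; split=> //; exact: subset_trans MB.
Qed.

(** An ascending chain with a nonzero member consists of nonzero, hence
invertible, ideals from that member on. *)
Lemma acc_invertible_noetherian : acc (@invertible_ideal D) ->
  (forall A, nonzero_ideal A -> invertible_ideal A) -> noetherian D.
Proof.
move=> acc_inv inv I iI incI.
have incn m n : (m <= n)%N -> I m `<=` I n.
  move=> /subnK <-; elim: (n - m)%N => [|k IHk] //.
  by rewrite addSn; exact: subset_trans IHk (incI _).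
have [[m nzm]|all0] := pselect (exists m, I m <> [set 0]); last first.
  have I0 n : I n = [set 0] by apply: contrapT => nzn; apply: all0; exists n.
  by exists 0%N => n _; rewrite !I0.
have [n|n|N stab] := acc_inv (fun n => I (m + n)%N).
- apply: inv; split=> // I0; apply: nzm; apply/seteqP; split.
    by rewrite -I0; apply: incn; exact: leq_addr.
  by move=> _ ->; exact: ideal0.
- by rewrite addnS; exact: incI.
- exists (m + N)%N => n le_n.
  have mn : (m <= n)%N by apply: leq_trans le_n; exact: leq_addr.
  by rewrite -(subnKC mn) stab// leq_subRL.
Qed.

End Integrality.

(** * The two characterizations *)

Section Characterizations.
Variable D : idomainType.
Hypothesis acc_inv : acc (@invertible_ideal D).

Lemma pid_iff_gamma_pi : is_pid D <->
  gamma_pi (@nonzero_ideal D)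
    [set P | [/\ nonzero_ideal P, proper_set P & principal_ideal P]].
Proof.
split=> [pid A [iA nA] properA|above A iA].
  by exists A => //; split=> //; exact: pid.
have [->|nzA] := pselect (A = [set 0]).
  exists 0; apply/seteqP; split=> [_ ->|_ [x _ <-]]; last by rewrite mulr0.
  by exists 0; rewrite // mulr0.
pose C : set (set D) := [set P | exists2 a, a != 0 & P = pideal a].
suff [a _ ->] : C A by exists a.
apply: (@gamma_pi_monoid_absorbs D C) => //.
- by move=> _ [a a0 ->]; exact: pideal_invertible.
- exists 1; first exact: oner_neq0.
  by apply/esym/ideal1_setT; [exact: pideal_ideal|exact: mem_pideal].
- move=> _ _ [a a0 ->] [b b0 ->]; exists (a * b); first exact: mulf_neq0.
  exact: imul_pideal.
- move=> B nzB properB.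
  have [P [[iP nzP] properP [a PE]] BP] := above B nzB properB.
  exists P => //; split=> //; exists a => //; apply/eqP => a0; apply: nzP.
  rewrite PE a0; apply/seteqP.
  split=> [_ [x _ <-]|_ ->]; first by rewrite mulr0.
  by exists 0; rewrite // mulr0.
Qed.

Lemma dedekind_iff_gamma_pi : dedekind D <->
  gamma_pi (@nonzero_ideal D) [set P | proper_set P /\ invertible_ideal P].
Proof.
split=> [ded A [iA nzA] properA|above].
  have [noeth _ _] := ded.
  have [M maxM AM] := noetherian_maximal_above noeth iA properA.
  exists M => //; split; first by case: maxM.
  have [a /AM Ma a0] := nonzero_elt iA nzA.
  exact: dedekind_maximal_invertible (neq_set0 Ma a0).
have inv (A : set D) : nonzero_ideal A -> invertible_ideal A.
  exact: (gamma_pi_monoid_absorbs (fun _ => id) (@setT_invertible D)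
            (@imul_invertible D) acc_inv above).
split.
- exact: acc_invertible_noetherian.
- exact: all_invertible_integrally_closed.
- exact: all_invertible_prime_maximal.
Qed.

End Characterizations.

Theorem theorem3p10 (D : idomainType) (hD : ~ GRing.field_axiom D)
    (hacc : noetherian D \/ acc (@invertible_ideal D)) :
  (is_pid D <->
     gamma_pi (@nonzero_ideal D)
       [set P | [/\ nonzero_ideal P, proper_set P & principal_ideal P]]) /\
  (dedekind D <->
     gamma_pi (@nonzero_ideal D)
       [set P | proper_set P /\ invertible_ideal P]).
Proof.
have acc_inv : acc (@invertible_ideal D).
  case: hacc => // noeth I invI; apply: noeth => n; exact: (invI n).1.
by split; [exact: pid_iff_gamma_pi|exact: dedekind_iff_gamma_pi].
Qed.
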